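(* Let $f(X;W)=\overline{O}(\overline{I}(X)\,\overline{P}(W))$ be an $(\overline{O},\overline{I},\overline{P})$-expressible layer with $\overline{I}(X)\in\mathbb{R}^{G\times N\times I}$ and $\overline{P}(W)\in\mathbb{R}^{G\times I\times O}$, where $X$ is a batch of $B$ calibration inputs of the layer and $W$ its parameter tensor. For each group $g\in\{1,\dots,G\}$ let $M_g\in\mathbb{R}^{I\times I}$ be an uncentered whitening matrix for $\overline{I}(X)_g\in\mathbb{R}^{N\times I}$. Let $U=\min(I,O)$, let $\sigma_{g,1}\ge\dots\ge\sigma_{g,U}\ge 0$ be the singular values of $M_g^{+}\,\overline{P}(W)_g\in\mathbb{R}^{I\times O}$, and let $P\in\{1,\dots,U\}$. Then the activation distortion incurred by replacing $W$ with its activation-aware rank-$P$ projection $\mathcal{T}^{\mathrm{AA}}_P(W)$ is $$\frac1B\bigl\|f(X;W)-f\bigl(X;\mathcal{T}^{\mathrm{AA}}_P(W)\bigr)\bigr\|_F^2=\frac{N}{B}\sum_{g=1}^{G}\sum_{i=P+1}^{U}\sigma_{g,i}^2 .$$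
   Context: **Tensors and batched operations.** All tensors are real. $\|\cdot\|_F$ is the tensor Frobenius norm (the Euclidean norm of the flattened tensor). For third-order tensors $A\in\mathbb{R}^{G\times N\times I}$ and $C\in\mathbb{R}^{G\times I\times O}$, the product $AC\in\mathbb{R}^{G\times N\times O}$ is batched: $(AC)_g=A_gC_g$ for $g=1,\dots,G$. $G$ is called the number of groups. **Expressible layers.** A layer $f$ is $(\overline{O},\overline{I},\overline{P})$-expressible if $f(X;W)=\overline{O}(\overline{I}(X)\,\overline{P}(W))$, where $\overline{O}$ (defined on $\mathbb{R}^{G\times N\times O}$) and $\overline{P}$ (with values in $\mathbb{R}^{G\times I\times O}$) are compositions of reshape and permute-axes operators (hence bijections that only rearrange entries), and $\overline{I}$ is a linear operator with values in $\mathbb{R}^{G\times N\times I}$. Here $N$ (the outer dimension) need not equal the number $B\ge1$ of samples. **Truncated SVD.** For a matrix $A$ with SVD $A=U_A\Sigma V^\top$ (singular values in decreasing order), $\mathcal{T}^{\mathrm{SVD}}_P(A)=(U_A)_{:,:P}\,\Sigma_{:P,:P}\,(V_{:,:P})^\top$ keeps the $P$ largest singular values and their singular vectors; if the SVD is not unique, an arbitrary one is fixed. **Uncentered whitening matrix.** For $X'\in\mathbb{R}^{N\times I}$ of rank $R$ (possibly $R<I$), a matrix $M\in\mathbb{R}^{I\times I}$ is an uncentered whitening matrix for $X'$ if $M^\top X'^\top X' M=N\,\overline{\mathbf I}_R$ and $\operatorname{range}(M)=\operatorname{row}(X')$, where $\overline{\mathbf I}_R\in\mathbb{R}^{I\times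 I}$ is the diagonal matrix with ones in the first $R$ diagonal positions and zeros elsewhere, and $\operatorname{row}(X')\subseteq\mathbb{R}^I$ is the row space. $M^{+}$ denotes the Moore–Penrose inverse. **Activation-aware projection.** $\mathcal{T}^{\mathrm{AA}}_P(W)=\overline{P}^{-1}(C)$, where $C\in\mathbb{R}^{G\times I\times O}$ has groups $C_g=M_g\,\mathcal{T}^{\mathrm{SVD}}_P\bigl(M_g^{+}\,\overline{P}(W)_g\bigr)$. *)

(* Defs.v *)
From HB Require Import structures.
From mathcomp Require Import all_boot all_order all_fingroup all_algebra.
From mathcomp Require Import reals.

Set Implicit Arguments.
Unset Strict Implicit.
Unset Printing Implicit Defensive.

Import GRing.Theory Num.Theory.
Local Open Scope ring_scope.

(* A multi-index of shape [:: n1; ...; nr] is (i1, (i2, ... (ir, tt))), with   *)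
(* 0-based coordinates.                                                       *)
Fixpoint midx (s : seq nat) : finType :=
  if s is n :: s' then ('I_n * midx s')%type else unit.

(* The values are in R^o so that tensors form an lmodType over R. *)
Definition tensor (R : realType) (s : seq nat) := {ffun midx s -> R^o}.

Fixpoint coords (s : seq nat) : midx s -> seq nat :=
  match s return midx s -> seq nat with
  | [::] => fun=> [::]
  | n :: s' => fun i : 'I_n * midx s' => val i.1 :: coords i.2
  end.

(* Row-major position of an entry in the flattened tensor. *)
Fixpoint position (s : seq nat) : midx s -> nat :=
  match s return midx s -> nat with
  | [::] => fun=> 0%N
  | n :: s' => fun i : 'I_n * midx s' =>
      (val i.1 * \prod_(m <- s') m + position i.2)%N
  end.

Definition is_reshape (R : realType) (s t : seq nat)
    (f : tensor R s -> tensor R t) : Prop :=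
  (\prod_(m <- s) m = \prod_(m <- t) m)%N /\
  forall (x : tensor R s) (i : midx s) (j : midx t),
    position i = position j -> f x j = x i.

Definition permute_seq (n : nat) (a : 'S_n) (u : seq nat) : seq nat :=
  [seq nth 0%N u (a k) | k <- enum 'I_n].

(* Axis k of the result is axis (a k) of the argument. *)
Definition is_permute_axes (R : realType) (s t : seq nat)
    (f : tensor R s -> tensor R t) : Prop :=
  exists a : 'S_(size s),
    t = permute_seq a s /\
    forall (x : tensor R s) (i : midx s) (j : midx t),
      coords j = permute_seq a (coords i) -> f x j = x i.

Inductive rearrangement (R : realType) :
    forall s t : seq nat, (tensor R s -> tensor R t) -> Prop :=
| rearrangement_reshape s t (f : tensor R s -> tensor R t) :
    is_reshape f -> rearrangement f
| rearrangement_permute s t (f : tensor R s -> tensor R t) :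
    is_permute_axes f -> rearrangement f
| rearrangement_comp s t u (f : tensor R s -> tensor R t)
    (g : tensor R t -> tensor R u) :
    rearrangement f -> rearrangement g -> rearrangement (g \o f).

Definition fnorm (R : realType) (s : seq nat) (x : tensor R s) : R :=
  Num.sqrt (\sum_(i : midx s) (x i : R) ^+ 2).

Definition slice (R : realType) (G m n : nat) (x : tensor R [:: G; m; n])
    (g : 'I_G) : 'M[R]_(m, n) :=
  \matrix_(i, j) x (g, (i, (j, tt))).

Definition stack (R : realType) (G m n : nat) (A : 'I_G -> 'M[R]_(m, n)) :
    tensor R [:: G; m; n] :=
  [ffun k : 'I_G * ('I_m * ('I_n * unit)) => A k.1 k.2.1 k.2.2.1].

Definition bmul (R : realType) (G m n p : nat)
    (x : tensor R [:: G; m; n]) (y : tensor R [:: G; n; p]) :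
    tensor R [:: G; m; p] :=
  stack (fun g => slice x g *m slice y g).

Definition expressible (R : realType) (G N I O : nat) (sX sW sY : seq nat)
    (Obar : tensor R [:: G; N; O] -> tensor R sY)
    (Ibar : {linear tensor R sX -> tensor R [:: G; N; I]})
    (Pbar : tensor R sW -> tensor R [:: G; I; O])
    (f : tensor R sX -> tensor R sW -> tensor R sY) : Prop :=
  [/\ rearrangement Obar, rearrangement Pbar &
      forall X W, f X W = Obar (bmul (Ibar X) (Pbar W))].

(* The product pid_mx *m diag_mx s *m pid_mx is the m x n matrix with main    *)
(* diagonal s and zeros elsewhere.                                            *)
Definition is_svd (R : realType) (m n : nat) (A : 'M[R]_(m, n))
    (U : 'M[R]_m) (s : 'rV[R]_(minn m n)) (V : 'M[R]_n) : Prop :=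
  [/\ U^T *m U = 1%:M, V^T *m V = 1%:M,
      (forall i, 0 <= s 0 i),
      (forall i j : 'I_(minn m n), (i <= j)%N -> s 0 j <= s 0 i) &
      A = U *m (pid_mx (minn m n) *m diag_mx s *m pid_mx (minn m n)) *m V^T].

Definition singular_values (R : realType) (m n : nat) (A : 'M[R]_(m, n))
    (s : 'rV[R]_(minn m n)) : Prop :=
  exists (U : 'M[R]_m) (V : 'M[R]_n), is_svd A U s V.

Definition truncated_svd (R : realType) (m n P : nat) (hP : (P <= minn m n)%N)
    (U : 'M[R]_m) (s : 'rV[R]_(minn m n)) (V : 'M[R]_n) : 'M[R]_(m, n) :=
  colsub (widen_ord (leq_trans hP (geq_minl m n))) U
    *m diag_mx (colsub (widen_ord hP) s)
    *m (colsub (widen_ord (leq_trans hP (geq_minr m n))) V)^T.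

Definition moore_penrose (R : realType) (m n : nat)
    (A : 'M[R]_(m, n)) (B : 'M[R]_(n, m)) : Prop :=
  [/\ A *m B *m A = A, B *m A *m B = B,
      (A *m B)^T = A *m B & (B *m A)^T = B *m A].

(* Range of M = row space of M^T, as %MS compares row spaces. *)
Definition uncentered_whitening (R : realType) (N I : nat)
    (X : 'M[R]_(N, I)) (M : 'M[R]_I) : Prop :=
  M^T *m X^T *m X *m M = N%:R *: pid_mx (\rank X) /\ (M^T == X)%MS.

(* The SVD of each Mp g *m slice (Pbar W) g enters through its factors U g,   *)
(* s g, V g, so that any choice of SVD is allowed.                            *)
Definition aa_projection (R : realType) (G I O P : nat) (sW : seq nat)
    (Pbar_inv : tensor R [:: G; I; O] -> tensor R sW) (M : 'I_G -> 'M[R]_I)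
    (hP : (P <= minn I O)%N)
    (U : 'I_G -> 'M[R]_I) (s : 'I_G -> 'rV[R]_(minn I O))
    (V : 'I_G -> 'M[R]_O) : tensor R sW :=
  Pbar_inv (stack (fun g => M g *m truncated_svd hP (U g) (s g) (V g))).

(* Main.v *)
(* Write Y = Ibar(X)_g, A = M_g^+ Pbar(W)_g, and let T be its truncated SVD.   *)
(* Reshapes and axis permutations preserve the Frobenius norm, so the          *)
(* distortion splits into the groups' |Y Pbar(W)_g - Y M_g T|^2. Since M_g     *)
(* M_g^+ is the orthogonal projection onto row(Y), this is |Y M_g (A - T)|^2,  *)
(* and the Gram matrix of Y M_g is N times the partial identity E of rank      *)
(* rank(Y). Finally E fixes A - T: Y M_g (1 - E) = 0, hence M_g = M_g E, so    *)
(* the range of M_g^+ lies in that of E, and T = A K for a projection K.       *)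
(* Thus each group contributes N |A - T|^2, the sum of the discarded squared   *)
(* singular values; these do not depend on the SVD since the characteristic    *)
(* polynomial of A A^T determines them.                                        *)

Require Import Defs.
From HB Require Import structures.
From mathcomp Require Import all_boot all_order all_fingroup all_algebra.
From mathcomp Require Import reals zify.

Import Order.TTheory GRing.Theory Num.Theory.
Local Open Scope ring_scope.

(** The argument rests on four facts. [whitening_distortion] turns the activation error of a group
    into [N] times a weight error, for any approximation of the form [A *m K]; [truncated_svdE] puts
    the truncated SVD in this form. [svd_residual] evaluates the weight error and
    [svd_values_unique] makes it independent of the chosen SVD. [rearrangement_fnormB] removes
    [Obar], after which the squared norm is a sum over groups. *)

Section LinearAlgebra.
Context {R : realType}.

(** * Squared Frobenius norm of matrices and Gram matrices *)

Definition fnorm2 {m n} (Z : 'M[R]_(m, n)) : R := \sum_i \sum_j Z i j ^+ 2.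

Lemma fnorm2E {m n} (Z : 'M[R]_(m, n)) : fnorm2 Z = \tr (Z *m Z^T).
Proof.
apply: eq_bigr => i _; rewrite !mxE; apply: eq_bigr => j _.
by rewrite mxE expr2.
Qed.

Lemma fnorm2E_tr {m n} (Z : 'M[R]_(m, n)) : fnorm2 Z = \tr (Z^T *m Z).
Proof. by rewrite fnorm2E mxtrace_mulC. Qed.

Lemma fnorm2_eq0 {m n} (Z : 'M[R]_(m, n)) : fnorm2 Z = 0 -> Z = 0.
Proof.
move=> Z0; apply/matrixP => i j; rewrite mxE; apply/eqP; rewrite -sqrf_eq0.
have /psumr_eq0P rows0 := Z0.
have /psumr_eq0P -> // : \sum_k Z i k ^+ 2 = 0.
  by apply: rows0 => // k _; apply: sumr_ge0 => l _; apply: sqr_ge0.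
by move=> k _; apply: sqr_ge0.
Qed.

(** The squared norm of [X *m Y] is the trace of [Y^T *m (X^T *m X *m Y)]. *)
Lemma gram_mul_eq0 {m n p} (X : 'M[R]_(m, n)) (Y : 'M[R]_(n, p)) :
  X^T *m X *m Y = 0 -> X *m Y = 0.
Proof.
move=> XXY0; apply: fnorm2_eq0.
by rewrite fnorm2E_tr trmx_mul -!mulmxA (mulmxA X^T) XXY0 mulmx0 mxtrace0.
Qed.

(** * Whitening matrices and their pseudoinverses *)

(** [M *m Mp] is the orthogonal projection onto the range of [M], which contains the rows of [X]. *)
Lemma pinv_range_id {N I} {X : 'M[R]_(N, I)} {M Mp : 'M[R]_I} :
  (X <= M^T)%MS -> moore_penrose M Mp -> X *m M *m Mp = X.
Proof.
move=> /submxP[Y ->] [MMpM _ MMpT _].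
by rewrite -!mulmxA -MMpT -trmx_mul MMpM.
Qed.

Lemma whitening_pid {N I} {X : 'M[R]_(N, I)} {M Mp : 'M[R]_I} :
  uncentered_whitening X M -> moore_penrose M Mp ->
  pid_mx (\rank X) *m Mp = Mp.
Proof.
move=> [XM /andP[rMX _]] [_ MpMMp _ MpMT].
set E := pid_mx _; set F : 'M[R]_I := copid_mx (\rank X).
have rX : (\rank X <= I)%N := rank_leq_col X.
have XMF0 : X *m M *m F = 0.
  apply: gram_mul_eq0; rewrite trmx_mul !mulmxA XM -scalemxAl.
  by rewrite mul_pid_mx_copid // scaler0.
(* The range of [M] lies in the row space of [X], where [X] is injective, so [X] can be cancelled
   from [XMF0]. *)
have MF0 : M *m F = 0.
  have [Y MXY] : exists Y, M = X^T *m Y.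
    by case/submxP: rMX => Y MY; exists Y^T; rewrite -trmx_mul -MY trmxK.
  rewrite MXY -mulmxA; apply: gram_mul_eq0.
  by rewrite trmxK -!mulmxA (mulmxA X^T) -MXY (mulmxA X) XMF0.
have EMT : E *m M^T = M^T.
  apply: trmx_inj; rewrite trmx_mul trmxK tr_pid_mx; apply/eqP.
  rewrite -subr_eq0 -oppr_eq0 opprB -{1}(mulmx1 M) -mulmxBr; apply/eqP.
  exact: MF0.
(* [Mp = (Mp *m M)^T *m Mp] starts with the factor [M^T], which the partial identity fixes. *)
by rewrite -[in LHS]MpMMp -MpMT trmx_mul 2!mulmxA EMT -trmx_mul MpMT MpMMp.
Qed.

(** The approximation is a right multiple of [Mp *m W], so the residual [D] keeps [Mp] as left
    factor and is fixed by the partial identity in the Gram matrix of [X *m M]. *)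
Lemma whitening_distortion {N I O} {X : 'M[R]_(N, I)} {M Mp : 'M[R]_I}
    (W : 'M[R]_(I, O)) (K : 'M[R]_O) :
  uncentered_whitening X M -> moore_penrose M Mp ->
  fnorm2 (X *m W - X *m (M *m (Mp *m W *m K))) =
  N%:R * fnorm2 (Mp *m W - Mp *m W *m K).
Proof.
move=> hM hMp; have [XM /andP[_ rXM]] := hM.
have -> : X *m W - X *m (M *m (Mp *m W *m K)) =
          X *m M *m (Mp *m W - Mp *m W *m K).
  by rewrite mulmxBr !mulmxA (pinv_range_id rXM hMp).
set D := _ - _.
have ED : pid_mx (\rank X) *m D = D.
  by rewrite mulmxBr !mulmxA (whitening_pid hM hMp).
have gram : (X *m M)^T *m (X *m M) = N%:R *: pid_mx (\rank X).
  by rewrite trmx_mul !mulmxA XM.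
rewrite !fnorm2E_tr trmx_mul -(mulmxA D^T) (mulmxA _ (X *m M)) gram.
by rewrite -scalemxAl ED -scalemxAr mxtraceZ.
Qed.

(** * Singular value decompositions: truncation, residual, uniqueness *)

Definition rect_diag m n (s : 'rV[R]_(minn m n)) : 'M[R]_(m, n) :=
  pid_mx (minn m n) *m diag_mx s *m pid_mx (minn m n).

Lemma rect_diag_gram m n (s : 'rV[R]_(minn m n)) :
  rect_diag m n s *m (rect_diag m n s)^T =
  pid_mx (minn m n) *m (diag_mx s *m diag_mx s) *m pid_mx (minn m n).
Proof.
rewrite !trmx_mul tr_diag_mx !tr_pid_mx !mulmxA.
rewrite -(mulmxA (pid_mx _ *m diag_mx s) (pid_mx _) (pid_mx _)) pid_mx_id ?geq_minr //.
by rewrite pid_mx_1 mulmx1.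
Qed.

Lemma fnorm2_rect_diag m n (s : 'rV[R]_(minn m n)) :
  fnorm2 (rect_diag m n s) = \sum_i s 0 i ^+ 2.
Proof.
rewrite fnorm2E rect_diag_gram mxtrace_mulC !mulmxA.
rewrite pid_mx_id ?geq_minl // pid_mx_1 mul1mx -{1}(tr_diag_mx s) -fnorm2E_tr.
rewrite /fnorm2; apply: eq_bigr => i _.
rewrite (bigD1 i) //= big1 ?addr0 => [|j /negPf ji].
  by rewrite mxE eqxx.
by rewrite mxE eq_sym ji expr0n.
Qed.

(** Truncation is composition with the orthogonal projection onto the span of the first [P] right
    singular vectors. *)
Lemma truncated_svdE {m n P} {A : 'M[R]_(m, n)} (hP : (P <= minn m n)%N)
    {U s V} :
  is_svd A U s V -> truncated_svd hP U s V = A *m (V *m pid_mx P *m V^T).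
Proof.
move=> [_ VV _ _ ->].
(* Keeping the first [P] columns is multiplication by a partial identity; the rest is algebra of
   such matrices. *)
have colsubE k p (h : (P <= k)%N) (B : 'M[R]_(p, k)) :
    colsub (widen_ord h) B = B *m pid_mx P.
  rewrite -[in LHS](mulmx1 B) -mulmx_colsub; congr (_ *m _).
  apply/matrixP => i j; rewrite !mxE -val_eqE /= andb_idr // => /eqP ->.
  exact: ltn_ord.
have diag_colsub : diag_mx (colsub (widen_ord hP) s) =
    pid_mx P *m diag_mx s *m pid_mx P.
  rewrite -colsubE -(trmxK (pid_mx P *m _)) trmx_mul tr_pid_mx -colsubE.
  by apply/matrixP => i j; rewrite !mxE -!val_eqE.
have pid_diagC : pid_mx P *m diag_mx s = diag_mx s *m pid_mx P.
  apply/matrixP => i j; rewrite mul_mx_diag mul_diag_mx !mxE.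
  by rewrite mulrC; case: (_ =P _) => [ij|_] /=; rewrite ?mulr0 ?mul0r // (val_inj ij).
have pidPm : pid_mx P =
    (pid_mx (minn m n) : 'M[R]_(m, minn m n)) *m (pid_mx P : 'M[R]_(minn m n)).
  by rewrite mul_pid_mx !(minn_idPr hP).
have pidPn : pid_mx P =
    (pid_mx (minn m n) : 'M[R]_(minn m n, n)) *m (pid_mx P : 'M[R]_n).
  by rewrite mul_pid_mx (minn_idPr hP) (minn_idPr (leq_trans hP (geq_minr m n))).
rewrite !mulmxA -(mulmxA _ V^T) VV mulmx1 /truncated_svd diag_colsub !colsubE.
rewrite trmx_mul tr_pid_mx !mulmxA -(mulmxA U (pid_mx P) (pid_mx P)).
rewrite pid_mx_id // -(mulmxA _ (pid_mx P) (pid_mx P)) pid_mx_id //.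
rewrite -[RHS]mulmxA -(mulmxA _ (pid_mx _) (pid_mx P *m _)) (mulmxA (pid_mx _)).
rewrite -pidPn pidPm -!mulmxA (mulmxA (pid_mx P) (diag_mx s)) pid_diagC.
by rewrite -!mulmxA (mulmxA (pid_mx P) (pid_mx P)) pid_mx_id.
Qed.

Lemma char_poly_conj {n} (U D : 'M[R]_n) :
  U^T *m U = 1%:M -> char_poly (U *m D *m U^T) = char_poly D.
Proof.
move=> UU; rewrite /char_poly /char_poly_mx.
have UU' : map_mx polyC U *m map_mx polyC U^T = 1%:M.
  by rewrite -map_mxM (mulmx1C UU) map_mx1.
have -> : 'X%:M - map_mx polyC (U *m D *m U^T) =
  map_mx polyC U *m ('X%:M - map_mx polyC D) *m map_mx polyC U^T.
  by rewrite mulmxBr mulmxBl !map_mxM scalar_mxC -(mulmxA _%:M) UU' mulmx1.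
by rewrite !det_mulmx mulrAC -det_mulmx UU' det1 mul1r.
Qed.

(** The characteristic polynomial gives the entries as a multiset, and a multiset has one decreasing
    arrangement. *)
Lemma diag_char_poly_inj {n} (d e : 'rV[R]_n) :
    (forall i j : 'I_n, (i <= j)%N -> d 0 j <= d 0 i) ->
    (forall i j : 'I_n, (i <= j)%N -> e 0 j <= e 0 i) ->
  char_poly (diag_mx d) = char_poly (diag_mx e) -> d = e.
Proof.
have charE (c : 'rV[R]_n) :
    char_poly (diag_mx c) = \prod_(x <- [seq c 0 i | i <- enum 'I_n]) ('X - x%:P).
  rewrite char_poly_trig ?diag_mx_is_trig // big_map big_enum /=.
  by apply: eq_bigr => i _; rewrite mxE eqxx.
have srt (c : 'rV[R]_n) : (forall i j : 'I_n, (i <= j)%N -> c 0 j <= c 0 i) ->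
    sorted >=%R [seq c 0 i | i <- enum 'I_n].
  move=> c_dec; rewrite sorted_map.
  apply: (@sub_sorted _ (relpre val leq)) => [i j /= ij|]; first exact: c_dec.
  by rewrite -sorted_map val_enum_ord iota_sorted.
move=> d_dec e_dec; rewrite !charE => /prod_XsubC_eq /esym de.
have /eq_in_map {}de : [seq d 0 i | i <- enum 'I_n] = [seq e 0 i | i <- enum 'I_n].
  by apply: (sorted_eq ge_trans ge_anti); rewrite ?srt // perm_sym.
by apply/rowP => i; apply: de; rewrite mem_enum.
Qed.

Lemma fnorm2_conj {m n} (U : 'M[R]_m) (S : 'M[R]_(m, n)) (V : 'M[R]_n) :
  U^T *m U = 1%:M -> V^T *m V = 1%:M -> fnorm2 (U *m S *m V^T) = fnorm2 S.
Proof.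
move=> UU VV; rewrite fnorm2E trmx_mul trmxK mulmxA -(mulmxA _ V^T) VV mulmx1.
by rewrite -fnorm2E !fnorm2E_tr trmx_mul -mulmxA (mulmxA U^T) UU mul1mx.
Qed.

Lemma svd_residual {m n P} {A : 'M[R]_(m, n)} {U s V} :
    (P <= minn m n)%N -> is_svd A U s V ->
  fnorm2 (A - A *m (V *m pid_mx P *m V^T)) =
  \sum_(i < minn m n | (P <= i)%N) s 0 i ^+ 2.
Proof.
move=> hP [UU VV _ _ ->]; rewrite -/(rect_diag m n s).
(* The kept part of [s]. Indices start at 0, so [s - t] starts at index [P], the singular value
   number [P + 1]. *)
pose t := \row_i (if (i < P)%N then s 0 i else 0).
have diag_pid : diag_mx s *m pid_mx P = diag_mx t.
  apply/matrixP => i j; rewrite mul_diag_mx !mxE.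
  by rewrite mulr_natr !mulrb val_eqE; case: (i == j); case: (i < P)%N.
have S_pid : rect_diag m n s *m pid_mx P = rect_diag m n t.
  rewrite /rect_diag -diag_pid -!mulmxA; do 2!congr (_ *m _).
  by rewrite !mul_pid_mx; congr pid_mx; lia.
have -> : U *m rect_diag m n s *m V^T *m (V *m pid_mx P *m V^T) =
          U *m rect_diag m n t *m V^T.
  rewrite -S_pid; move: (rect_diag m n s) => S.
  by rewrite !mulmxA -(mulmxA _ V^T) VV mulmx1.
rewrite -mulmxBl -mulmxBr fnorm2_conj // /rect_diag.
rewrite -mulmxBl -mulmxBr -raddfB -/(rect_diag m n _) fnorm2_rect_diag.
rewrite [RHS]big_mkcond; apply: eq_bigr => i _; rewrite !mxE.
by case: leqP; rewrite ?subrr ?subr0 ?expr0n.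
Qed.

Lemma svd_values_unique {m n} {A : 'M[R]_(m, n)} {U U' s s' V V'} :
  is_svd A U s V -> is_svd A U' s' V' -> s = s'.
Proof.
(* The squares of [t], padded with zeros to length [m]: the eigenvalues of the [m] by [m] matrix
   [A *m A^T], still in decreasing order. *)
pose d (t : 'rV[R]_(minn m n)) : 'rV[R]_m := (\row_j (t 0 j ^+ 2)) *m pid_mx (minn m n).
have d_lt t (k : 'I_(minn m n)) (i : 'I_m) : k = i :> nat -> d t 0 i = t 0 k ^+ 2.
  move=> ki; rewrite mxE (bigD1 k) //= big1 ?addr0 => [|l /negPf lk].
    by rewrite !mxE ki eqxx -ki ltn_ord mulr1.
  by rewrite !mxE -ki val_eqE lk mulr0.
have d_ge t (i : 'I_m) : (minn m n <= i)%N -> d t 0 i = 0.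
  move=> ri; rewrite mxE big1 // => k _; rewrite !mxE.
  by rewrite ltn_eqF ?mulr0 // (leq_trans (ltn_ord k)).
have d_dec W1 t W2 : is_svd A W1 t W2 ->
    forall i j : 'I_m, (i <= j)%N -> d t 0 j <= d t 0 i.
  move=> [_ _ t_ge0 t_dec _] i j ij; case: (ltnP j (minn m n)) => [jr|rj].
    have ir := leq_ltn_trans ij jr.
    rewrite (d_lt t (Ordinal ir) i) // (d_lt t (Ordinal jr) j) //.
    by rewrite lerXn2r ?nnegrE // t_dec.
  rewrite d_ge //; case: (ltnP i (minn m n)) => [ir|ri]; last by rewrite d_ge.
  by rewrite (d_lt _ (Ordinal ir)) // sqr_ge0.
have gram t : rect_diag m n t *m (rect_diag m n t)^T = diag_mx (d t).
  rewrite rect_diag_gram mulmx_diag; apply/matrixP => i j; rewrite mul_mx_diag.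
  rewrite !mxE -sumrMnl; apply: eq_bigr => k _.
  rewrite !mxE expr2 ltn_ord andbT.
  case: (eqVneq i j) => [->|ij]; rewrite ?mulr1n ?mulr0n.
    rewrite eq_sym andbT; case: (eqVneq (k : nat) j) => [<-|_] /=.
      by rewrite ltn_ord mul1r.
    by rewrite mul0r !mulr0.
  case: (eqVneq (i : nat) k) => [<-|_] /=; last by rewrite !mul0r.
  by rewrite val_eqE (negPf ij) mulr0.
have charA W1 t W2 : is_svd A W1 t W2 ->
    char_poly (A *m A^T) = char_poly (diag_mx (d t)).
  move=> [WW1 WW2 _ _ ->]; rewrite -gram -/(rect_diag m n t).
  move: (rect_diag m n t) => S; rewrite -[RHS](char_poly_conj W1) //.
  by rewrite !trmx_mul trmxK !mulmxA -(mulmxA _ W2^T) WW2 mulmx1.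
move=> svd svd'.
have dd' : d s = d s'.
  apply: diag_char_poly_inj; [exact: d_dec svd|exact: d_dec svd'|].
  by rewrite -(charA _ _ _ svd) (charA _ _ _ svd').
have [[_ _ s_ge0 _ _] [_ _ s'_ge0 _ _]] := (svd, svd').
apply/rowP => k; apply/eqP; rewrite -(eqrXn2 (n := 2)) //.
by rewrite -!(d_lt _ k (widen_ord (geq_minl m n) k)) // dd'.
Qed.

End LinearAlgebra.

(** * Multi-indices, row-major positions and axis permutations *)

Lemma card_midx s : #|midx s| = (\prod_(m <- s) m)%N.
Proof.
elim: s => [|n s IHs]; first by rewrite big_nil card_unit.
by rewrite big_cons card_prod card_ord IHs.
Qed.

Lemma position_lt {s} (i : midx s) : (position i < \prod_(m <- s) m)%N.
Proof.
elim: s i => [|n s IHs] /=; first by rewrite big_nil.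
move=> [i1 i2] /=; rewrite big_cons; have := IHs i2; have := ltn_ord i1.
by set p := (\prod_(m <- s) m)%N; nia.
Qed.

Lemma position_inj s : injective (@position s).
Proof.
elim: s => [[] [] //|n s IHs] [i1 i2] [j1 j2] /= eq_ij.
have := position_lt i2; have := position_lt j2; move: eq_ij.
set p := (\prod_(m <- s) m)%N => eq_ij lt_j lt_i.
have eq1 : i1 = j1.
  (* Division by [p] then recovers the leading coordinate. *)
  have p0 : (0 < p)%N by apply: leq_ltn_trans lt_i.
  have := congr1 (divn^~ p) eq_ij.
  by rewrite !divnMDl // !divn_small // !addn0 => /val_inj.
by move: eq_ij; rewrite eq1 => /addnI/IHs ->.
Qed.

Lemma position_surj {s} k : (k < \prod_(m <- s) m)%N ->
  exists i : midx s, position i = k.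
Proof.
move=> lt_k; pose pos (i : midx s) := Ordinal (position_lt i).
have pos_inj : injective pos by move=> i j [/position_inj].
have [|g _ gK] := inj_card_bij pos_inj; first by rewrite card_ord card_midx.
by exists (g (Ordinal lt_k)); rewrite -[LHS]/(val (pos _)) gK.
Qed.

Lemma size_coords {s} (i : midx s) : size (coords i) = size s.
Proof. by elim: s i => [|n s IHs] //= [i1 i2] /=; rewrite IHs. Qed.

Lemma coords_inj s : injective (@coords s).
Proof.
elim: s => [[] [] //|n s IHs] [i1 i2] [j1 j2] /= [/val_inj -> /IHs ->] //.
Qed.

Lemma coords_lt {s} (i : midx s) k :
  (k < size s)%N -> (nth 0%N (coords i) k < nth 0%N s k)%N.
Proof. by elim: s i k => [|n s IHs] //= [i1 i2] [|k] //= /IHs. Qed.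

Lemma coords_surj {s u} : size u = size s ->
  (forall k, (k < size s)%N -> (nth 0%N u k < nth 0%N s k)%N) ->
  exists i : midx s, coords i = u.
Proof.
elim: s u => [|n s IHs] [|c u] //=.
move=> [size_u] lt_u.
have [|i <-] := IHs u size_u; first by move=> k; apply: (lt_u k.+1).
by exists (Ordinal (lt_u 0%N isT), i).
Qed.

Lemma nth_permute_seq {n} (a : 'S_n) u (k : 'I_n) :
  nth 0%N (permute_seq a u) k = nth 0%N u (a k).
Proof. by rewrite (nth_map k) ?size_enum_ord // nth_ord_enum. Qed.

Lemma size_permute_seq {n} (a : 'S_n) u : size (permute_seq a u) = n.
Proof. by rewrite size_map size_enum_ord. Qed.

Lemma permute_seq_inj {n} (a : 'S_n) {u v} : size u = n -> size v = n ->
  permute_seq a u = permute_seq a v -> u = v.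
Proof.
move=> size_u size_v eq_uv; apply: (@eq_from_nth _ 0%N) => [|k].
  by rewrite size_u.
rewrite size_u => lt_k; have := nth_permute_seq a u (a^-1%g (Ordinal lt_k)).
by rewrite eq_uv nth_permute_seq permKV /= => ->.
Qed.

Lemma prod_permute_seq s (a : 'S_(size s)) :
  (\prod_(m <- permute_seq a s) m = \prod_(m <- s) m)%N.
Proof.
rewrite big_map big_enum /= [RHS](big_nth 0%N) big_mkord.
by rewrite [RHS](reindex_inj (@perm_inj _ a)).
Qed.

Lemma permute_coords s (a : 'S_(size s)) (i : midx s) :
  exists j : midx (permute_seq a s), coords j = permute_seq a (coords i).
Proof.
apply: coords_surj; rewrite !size_permute_seq // => k lt_k.
by rewrite !(nth_permute_seq a _ (Ordinal lt_k)) coords_lt.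
Qed.

(** * Rearrangements, slices and the tensor norm *)

Section Tensors.
Context {R : realType}.

(** Each source index has a matching target index; the matching is injective between index sets of
    equal size, hence bijective. *)
Lemma rearrangement_bij {s t} {f : tensor R s -> tensor R t} :
  rearrangement f ->
  exists phi : midx s -> midx t,
    bijective phi /\ forall x i, f x (phi i) = x i.
Proof.
elim=> {s t f} [s t f [eq_st fE] | s t f [a [eq_t fE]] |
                s t u f g _ [phi [phi_bij fE]] _ [psi [psi_bij gE]]].
- have ex_phi (i : midx s) : exists j : midx t, position j = position i.
    by apply: position_surj; rewrite -eq_st position_lt.
  have [phi phiE] := fin_all_exists ex_phi; exists phi; split=> [|x i]; last by apply: fE; rewrite phiE.
  apply: inj_card_bij => [i j eq_phi|]; last by rewrite !card_midx eq_st.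
  by apply: position_inj; rewrite -!phiE eq_phi.
- subst t; have [phi phiE] := fin_all_exists (permute_coords s a).
  exists phi; split=> [|x i]; last exact: fE.
  apply: inj_card_bij => [i j eq_phi|].
    apply: coords_inj; apply: (permute_seq_inj a); rewrite ?size_coords //.
    by rewrite -!phiE eq_phi.
  by rewrite !card_midx prod_permute_seq.
- exists (psi \o phi); split=> [|x i]; first exact: bij_comp.
  by rewrite /= gE fE.
Qed.

Lemma fnorm_sqr {s} (x : tensor R s) :
  fnorm x ^+ 2 = \sum_i (x i : R) ^+ 2.
Proof. by rewrite sqr_sqrtr //; apply: sumr_ge0 => i _; apply: sqr_ge0. Qed.

(** Entry [phi i] of [f x - f y] is entry [i] of [x - y]; stating it for differences avoids proving
    [f] additive. *)
Lemma rearrangement_fnormB {s t} {f : tensor R s -> tensor R t} x y :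
  rearrangement f -> fnorm (f x - f y) = fnorm (x - y).
Proof.
move=> /rearrangement_bij[phi [phi_bij fE]]; congr Num.sqrt.
rewrite (reindex phi) /=; last exact: onW_bij.
by apply: eq_bigr => i _; rewrite !ffunE !fE.
Qed.

Lemma fnorm_slices {G m n} (x : tensor R [:: G; m; n]) :
  fnorm x ^+ 2 = \sum_g fnorm2 (slice x g).
Proof.
rewrite fnorm_sqr /fnorm2.
under [RHS]eq_bigr => g _ do under eq_bigr => i _ do under eq_bigr => j _ do
  rewrite mxE.
under [RHS]eq_bigr => g _ do rewrite pair_bigA /=.
rewrite pair_bigA /=.
(* The bijection drops the final [tt] of a multi-index. *)
apply/esym; rewrite (reindex (fun k : midx [:: G; m; n] =>
  (k.1, (k.2.1, k.2.2.1)))) /=.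
  by apply: eq_bigr => -[g [i [j []]]].
by exists (fun k => (k.1, (k.2.1, (k.2.2, tt)))) => [[g [i [j []]]]|[g [i j]]].
Qed.

Lemma stackK {G m n} (A : 'I_G -> 'M[R]_(m, n)) g : slice (stack A) g = A g.
Proof. by apply/matrixP => i j; rewrite mxE ffunE. Qed.

Lemma sliceB {G m n} (x y : tensor R [:: G; m; n]) g :
  slice (x - y) g = slice x g - slice y g.
Proof. by apply/matrixP => i j; rewrite !mxE !ffunE. Qed.

End Tensors.

Theorem proposition4p7 (R : realType) (B G N I O P : nat) (sX sW sY : seq nat)
    (Obar : tensor R [:: G; N; O] -> tensor R sY)
    (Ibar : {linear tensor R (B :: sX) -> tensor R [:: G; N; I]})
    (Pbar : tensor R sW -> tensor R [:: G; I; O])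
    (Pbar_inv : tensor R [:: G; I; O] -> tensor R sW)
    (f : tensor R (B :: sX) -> tensor R sW -> tensor R sY)
    (X : tensor R (B :: sX)) (W : tensor R sW)
    (M Mp : 'I_G -> 'M[R]_I)
    (sigma : 'I_G -> 'rV[R]_(minn I O))
    (U : 'I_G -> 'M[R]_I) (s : 'I_G -> 'rV[R]_(minn I O)) (V : 'I_G -> 'M[R]_O)
    (hB : (0 < B)%N) (hP0 : (0 < P)%N) (hP : (P <= minn I O)%N)
    (hf : expressible Obar Ibar Pbar f)
    (hPbar : cancel Pbar Pbar_inv) (hPbar' : cancel Pbar_inv Pbar)
    (hM : forall g, uncentered_whitening (slice (Ibar X) g) (M g))
    (hMp : forall g, moore_penrose (M g) (Mp g))
    (hsigma : forall g, singular_values (Mp g *m slice (Pbar W) g) (sigma g))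
    (hsvd : forall g, is_svd (Mp g *m slice (Pbar W) g) (U g) (s g) (V g)) :
  B%:R^-1 * fnorm (f X W - f X (aa_projection Pbar_inv M hP U s V)) ^+ 2 =
  N%:R / B%:R *
    \sum_(g < G) \sum_(i < minn I O | (P <= i)%N) sigma g 0 i ^+ 2.
Proof.
have [Obar_re _ fE] := hf.
rewrite !fE (rearrangement_fnormB _ _ Obar_re) fnorm_slices /aa_projection hPbar'.
rewrite mulrC mulrAC; congr (_ / _).
rewrite mulr_sumr; apply: eq_bigr => g _; rewrite sliceB !stackK.
(* [sigma g] and [s g] may come from different decompositions; uniqueness identifies them. *)
have [U' [V' svd']] := hsigma g.
rewrite (svd_values_unique svd' (hsvd g)) (truncated_svdE hP (hsvd g)).
by rewrite (whitening_distortion _ _ (hM g) (hMp g)) (svd_residual hP (hsvd g)).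
Qed.
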